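(* Let $A=A^{\otimes}+\delta A$, where $A^{\otimes}$ is the symmetric positive definite factorising matrix of the context, and suppose that $\Delta:=\|(A^{\otimes})^{-1}\delta A\|_{A^{\otimes}}<1$. Let $M^{\otimes}$ be the iteration matrix of one tensor product multigrid V-cycle for $A^{\otimes}$ and suppose that this multigrid iteration converges with rate $\rho_A^{\otimes}=\|M^{\otimes}\|_{A^{\otimes}}<1$. For an integer $\mu\ge1$ consider the Richardson iteration for $A\mathbf u=\mathbf f$ preconditioned with $\mu$ multigrid V-cycles for $A^{\otimes}$, $$\mathbf u^{(k+1)}=\mathbf u^{(k)}+\left[\operatorname{Id}-(M^{\otimes})^{\mu}\right](A^{\otimes})^{-1}\left(\mathbf f-A\mathbf u^{(k)}\right).$$ Then at every step the error $\mathbf u^{(k)}-\mathbf u^*$ to the exact solution $\mathbf u^*=A^{-1}\mathbf f$ is reduced in the norm $\|\cdot\|_{A^{\otimes}}$ by a factor $$\rho_A=\left\|\operatorname{Id}-\left[\operatorname{Id}-(M^{\otimes})^{\mu}\right](A^{\otimes})^{-1}A\right\|_{A^{\otimes}}\le\Delta+(1+\Delta)(\rho_A^{\otimes})^{\mu}.$$ Consequently, for arbitrary $\Delta<1$ one has $\rho_A<1$ provided $\mu>\log_{\rho_A^{\otimes}}\big((1-\Delta)/(1+\Delta)\big)$ (where $\rho_A^{\otimes}>0$); and for $\mu=1$ one has $\rho_A<1$ provided $\Delta<(1-\rho_A^{\otimes})/(1+\rho_A^{\otimes})$.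
   Context: Continuous problem. Let $\mathcal S$ be the unit sphere in $\mathbb R^3$, $H>0$, $\Omega=\mathcal S\times[1,1+H]$ a spherical shell with coordinates $(r,\hat{\boldsymbol r})$, $\omega>0$, and $\nabla_{\mathcal S}$ the tangential gradient on $\mathcal S$. Consider $-\omega^2\nabla\cdot(\underline\alpha\nabla u)+\beta u=f$ on $\Omega$ with factorising coefficients $\underline\alpha=\operatorname{diag}\big(\alpha_r^r(r)\alpha_r^{\mathcal S}(\hat{\boldsymbol r}),\ \alpha_{\mathcal S}^r(r)\underline\alpha_{\mathcal S}^{\mathcal S}(\hat{\boldsymbol r})\big)$ (block diagonal, radial and tangential parts) and $\beta=\beta^r(r)\beta^{\mathcal S}(\hat{\boldsymbol r})$, where $\beta^{\mathcal S}=\alpha_r^{\mathcal S}$, the $2\times2$ matrix $\underline\alpha_{\mathcal S}^{\mathcal S}$ is symmetric positive definite, and $\alpha_{\mathcal S}^r,\alpha_r^r,\alpha_r^{\mathcal S},\beta^r>0$. Discretisation. Let $V^r$ be a finite element space on $[1,1+H]$ with $\dim V^r=n_r$, and let $V_0^{\mathcal S}\subset V_1^{\mathcal S}\subset\dots\subset V_L^{\mathcal S}=V^{\mathcal S}$ be nested finite element spaces on $\mathcal S$. The problem is discretised on level $\ell$ in $V_\ell=V^r\otimes V_\ell^{\mathcal S}$. Let $A^r,B^r,M^r\in\mathbb R^{n_r\times n_r}$ be the Galerkin matrices on $V^r$ of $\int_1^{1+H}\alpha_r^r\,\partial_ru^r\,\partial_rv^r\,dr$, $\int_1^{1+H}\beta^r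 u^rv^r\,dr$, $\int_1^{1+H}\alpha_{\mathcal S}^r u^rv^r\,dr$ respectively, and let $A_\ell^{\mathcal S},M_\ell^{\mathcal S}$ be the Galerkin matrices on $V_\ell^{\mathcal S}$ of $\int_{\mathcal S}\langle\underline\alpha_{\mathcal S}^{\mathcal S}\nabla_{\mathcal S}u^{\mathcal S},\nabla_{\mathcal S}v^{\mathcal S}\rangle\,d\hat{\boldsymbol r}$ and $\int_{\mathcal S}\alpha_r^{\mathcal S}u^{\mathcal S}v^{\mathcal S}\,d\hat{\boldsymbol r}$. The factorising system matrix on level $\ell$ is $$A^\otimes_\ell=(\omega^2A^r+B^r)\otimes M_\ell^{\mathcal S}+\omega^2M^r\otimes A_\ell^{\mathcal S},\qquad A^\otimes=A^\otimes_L,$$ which is symmetric positive definite. $A$ is the (possibly non-factorising) system matrix of the same size as $A^\otimes$, and $\delta A=A-A^\otimes$. Tensor product multigrid V-cycle for $A^\otimes$. $P_\ell^{\mathcal S}:V_\ell^{\mathcal S}\to V_{\ell+1}^{\mathcal S}$ is the horizontal prolongation, $R_\ell^{\mathcal S}=(P_\ell^{\mathcal S})^T$, $P_\ell=\operatorname{Id}\otimes P_\ell^{\mathcal S}$, $R_\ell=\operatorname{Id}\otimes R_\ell^{\mathcal S}$, $A^\otimes_\ell=R_\ell A^\otimes_{\ell+1}P_\ell$. The block smoother is $W^\otimes_\ell=(\omega^2A^r+B^r)\otimes W_\ell^{M,\mathcal S}+\omega^2M^r\otimes W_\ell^{A,\mathcal S}$ with horizontal matrices $W_\ell^{M,\mathcal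 S},W_\ell^{A,\mathcal S}$ (e.g. weighted diagonals of $M_\ell^{\mathcal S}$, $A_\ell^{\mathcal S}$). On level $\ell$ with right hand side $\mathbf f_\ell$ and initial guess $\mathbf u_\ell$: (1) perform $\nu_\ell^{\text{pre}}$ steps of $\mathbf u_\ell\to(W^\otimes_\ell)^{-1}\mathbf f_\ell+(I-(W^\otimes_\ell)^{-1}A^\otimes_\ell)\mathbf u_\ell$; (2) if $\ell>0$: set $\mathbf r_\ell=\mathbf f_\ell-A^\otimes_\ell\mathbf u_\ell$, apply the algorithm recursively on level $\ell-1$ with $\mathbf f_{\ell-1}=R_{\ell-1}\mathbf r_\ell$ and $\mathbf u_{\ell-1}=0$, then update $\mathbf u_\ell\to\mathbf u_\ell+P_{\ell-1}\mathbf u_{\ell-1}$; (3) perform $\nu_\ell^{\text{post}}$ further smoothing steps as in (1). The iteration matrix $M^\otimes$ is defined by the error map of one V-cycle on level $L$: $\mathbf u-\mathbf u^*_\otimes\mapsto M^\otimes(\mathbf u-\mathbf u^*_\otimes)$, where $A^\otimes\mathbf u^*_\otimes=\mathbf f$. Conventions. $\|\cdot\|_{A^\otimes}$ is the (operator) norm induced by the energy norm $\|\mathbf v\|_{A^\otimes}=\langle\mathbf v,A^\otimes\mathbf v\rangle^{1/2}$. ''The error is reduced by a factor $\rho_A$'' means $\|\mathbf u^{(k+1)}-\mathbf u^*\|_{A^\otimes}\le\rho_A\|\mathbf u^{(k)}-\mathbf u^*\|_{A^\otimes}$. *)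

(* Defs.v *)
From mathcomp Require Import all_boot all_order all_algebra.
From mathcomp Require Import mxtens.
From mathcomp Require Import all_classical all_reals all_analysis.

Set Implicit Arguments.
Unset Strict Implicit.
Unset Printing Implicit Defensive.

Import Order.TTheory GRing.Theory Num.Theory.
Import numFieldNormedType.Exports.

Local Open Scope classical_set_scope.
Local Open Scope ring_scope.

Section LinearAlgebra.
Context {R : realType}.

Definition spdmx n (A : 'M[R]_n) : Prop :=
  A^T = A /\ forall v : 'cV[R]_n, v != 0 -> 0 < (v^T *m A *m v) 0 0.

Definition energy_norm n (A : 'M[R]_n) (v : 'cV[R]_n) : R :=
  Num.sqrt ((v^T *m (A *m v)) 0 0).

(* The closed unit ball, rather than the unit sphere, makes the norm 0 when
   n = 0. *)
Definition energy_opnorm n (A B : 'M[R]_n) : R :=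
  sup [set energy_norm A (B *m v) | v in [set v | energy_norm A v <= 1]].

Definition rlog (b x : R) : R := ln x / ln b.

End LinearAlgebra.

Section Sphere.
Context {R : realType}.

Definition sphere : set 'rV[R]_3 := [set x | \sum_k x 0 k ^+ 2 = 1].

(* Colatitude p.1 and longitude p.2. *)
Definition sph (p : R * R) : 'rV[R]_3 :=
  \row_k [:: sin p.1 * cos p.2; sin p.1 * sin p.2; cos p.1]`_k.

Definition sph_dom : set (R * R) := `[0, pi] `*` `[0, 2 * pi].

(* The argument is a function of the angles, because tangential gradients are
   given by components in a frame that depends on the chart. *)
Definition int_sphere (g : R * R -> R) : R :=
  \int[(@lebesgue_measure R \x @lebesgue_measure R)%E]_(p in sph_dom)
    (g p * sin p.1).

Definition integrable_sphere (g : R * R -> R) : Prop :=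
  (@lebesgue_measure R \x @lebesgue_measure R)%E.-integrable sph_dom
    (fun p => (g p * sin p.1)%:E).

(* Components of the tangential gradient in the orthonormal frame
   (e_theta, e_phi); the poles, where the frame is undefined, are a null set. *)
Definition grad_sphere (u : 'rV[R]_3 -> R) (p : R * R) : 'cV[R]_2 :=
  \col_k [:: derive1 (fun t => u (sph (t, p.2))) p.1;
             (sin p.1)^-1 * derive1 (fun t => u (sph (p.1, t))) p.2]`_k.

End Sphere.

(* Each coefficient is only assumed integrable: with Lipschitz finite element
   functions this is enough for all the Galerkin integrals below to exist.
   There is no separate field for the horizontal factor of beta, which is
   assumed equal to [arS]. *)
Record shell_problem (R : realType) := ShellProblem {
  height : R;
  omega : R;
  arr : R -> R;             (* radial factor of the radial diffusion *)
  aSr : R -> R;             (* radial factor of the tangential diffusion *)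
  br : R -> R;              (* radial factor of beta *)
  arS : 'rV[R]_3 -> R;      (* horizontal factor of the radial diffusion *)
  aSS : 'rV[R]_3 -> 'M[R]_2; (* horizontal factor of the tangential diffusion,
                               in the frame (e_theta, e_phi) *)
  height_gt0 : 0 < height;
  omega_gt0 : 0 < omega;
  arr_gt0 : forall r, 1 <= r <= 1 + height -> 0 < arr r;
  aSr_gt0 : forall r, 1 <= r <= 1 + height -> 0 < aSr r;
  br_gt0 : forall r, 1 <= r <= 1 + height -> 0 < br r;
  arS_gt0 : forall x, sphere x -> 0 < arS x;
  aSS_spd : forall x, sphere x -> spdmx (aSS x);
  arr_int : lebesgue_measure.-integrable `[1, 1 + height] (EFin \o arr);
  aSr_int : lebesgue_measure.-integrable `[1, 1 + height] (EFin \o aSr);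
  br_int : lebesgue_measure.-integrable `[1, 1 + height] (EFin \o br);
  arS_int : integrable_sphere (arS \o sph);
  aSS_int : forall i j, integrable_sphere (fun p => aSS (sph p) i j)
}.

(* Finite element spaces are given by bases of Lipschitz functions, so that the
   weak derivatives are the classical derivatives, which exist almost
   everywhere. Only the horizontal levels l <= nlev are meaningful. *)
Record tensor_fem (R : realType) (pb : shell_problem R) := TensorFem {
  nr : nat;
  phir : 'I_nr -> R -> R;
  phir_lip : forall i,
    [lipschitz phir i r | r in (`[1, 1 + height pb] : set R)];
  phir_free : forall c : 'I_nr -> R,
    (forall r, 1 <= r <= 1 + height pb -> \sum_i c i * phir i r = 0) ->
    forall i, c i = 0;
  nlev : nat;
  nS : nat -> nat;
  phiS : forall l, 'I_(nS l) -> 'rV[R]_3 -> R;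
  phiS_lip : forall l (i : 'I_(nS l)), (l <= nlev)%N ->
    [lipschitz phiS i x | x in sphere];
  phiS_free : forall l (c : 'I_(nS l) -> R), (l <= nlev)%N ->
    (forall x, sphere x -> \sum_i c i * phiS i x = 0) -> forall i, c i = 0;
  phiS_nested : forall l (j : 'I_(nS l)), (l < nlev)%N ->
    exists c : 'I_(nS l.+1) -> R,
      forall x, sphere x -> phiS j x = \sum_i c i * phiS i x
}.

Section Matrices.
Context {R : realType} {pb : shell_problem R} (fe : tensor_fem pb).

Definition Ar : 'M[R]_(nr fe) := \matrix_(i, j)
  \int[lebesgue_measure]_(r in `[1, 1 + height pb])
    (arr pb r * derive1 (phir j) r * derive1 (phir i) r).

Definition Br : 'M[R]_(nr fe) := \matrix_(i, j)
  \int[lebesgue_measure]_(r in `[1, 1 + height pb])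
    (br pb r * phir j r * phir i r).

Definition Mr : 'M[R]_(nr fe) := \matrix_(i, j)
  \int[lebesgue_measure]_(r in `[1, 1 + height pb])
    (aSr pb r * phir j r * phir i r).

Definition AS l : 'M[R]_(nS fe l) := \matrix_(i, j)
  int_sphere (fun p => ((aSS pb (sph p) *m grad_sphere (phiS j) p)^T
                        *m grad_sphere (phiS i) p) 0 0).

Definition MS l : 'M[R]_(nS fe l) := \matrix_(i, j)
  int_sphere (fun p => arS pb (sph p) * phiS j (sph p) * phiS i (sph p)).

Definition tensor_mx l (XM XA : 'M[R]_(nS fe l)) : 'M[R]_(nr fe * nS fe l) :=
  (omega pb ^+ 2 *: Ar + Br) *t XM + (omega pb ^+ 2 *: Mr) *t XA.

Definition At l : 'M[R]_(nr fe * nS fe l) := tensor_mx (MS l) (AS l).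

End Matrices.

(* [PS l] represents the inclusion of level l into level l + 1. The Galerkin
   identity [At_galerkin] then holds mathematically; it is recorded because the
   cycle is formulated with it. *)
Record tensor_mg (R : realType) (pb : shell_problem R) (fe : tensor_fem pb) :=
  TensorMG {
  PS : forall l, 'M[R]_(nS fe l.+1, nS fe l);
  WMS : forall l, 'M[R]_(nS fe l);
  WAS : forall l, 'M[R]_(nS fe l);
  nu_pre : nat -> nat;
  nu_post : nat -> nat;
  PS_incl : forall l (j : 'I_(nS fe l)), (l < nlev fe)%N ->
    forall x, sphere x -> phiS j x = \sum_i PS l i j * phiS i x;
  At_galerkin : forall l, (l < nlev fe)%N ->
    At fe l = (1%:M *t (PS l)^T) *m At fe l.+1 *m (1%:M *t PS l);
  Wt_unit : forall l, (l <= nlev fe)%N ->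
    tensor_mx (WMS l) (WAS l) \in unitmx
}.

Section Multigrid.
Context {R : realType} {pb : shell_problem R} {fe : tensor_fem pb}.
Variable mg : tensor_mg fe.

Local Notation vec l := 'cV[R]_(nr fe * nS fe l).

Definition Wt l : 'M[R]_(nr fe * nS fe l) := tensor_mx (WMS mg l) (WAS mg l).

Definition Pt l : 'M[R]_(nr fe * nS fe l.+1, nr fe * nS fe l) :=
  1%:M *t PS mg l.

Definition Rt l : 'M[R]_(nr fe * nS fe l, nr fe * nS fe l.+1) :=
  1%:M *t (PS mg l)^T.

Definition smooth l (f u : vec l) : vec l :=
  invmx (Wt l) *m f + (1%:M - invmx (Wt l) *m At fe l) *m u.

Fixpoint vcycle l : vec l -> vec l -> vec l :=
  match l with
  | 0%N => fun f u =>
      iter (nu_post mg 0) (smooth f) (iter (nu_pre mg 0) (smooth f) u)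
  | l'.+1 => fun f u =>
      let u1 := iter (nu_pre mg l'.+1) (smooth f) u in
      let r := f - At fe l'.+1 *m u1 in
      let u2 := u1 + Pt l' *m vcycle (Rt l' *m r) 0 in
      iter (nu_post mg l'.+1) (smooth f) u2
  end.

Definition iteration_matrix (M : 'M[R]_(nr fe * nS fe (nlev fe))) : Prop :=
  forall f u ustar : vec (nlev fe), At fe (nlev fe) *m ustar = f ->
    vcycle f u - ustar = M *m (u - ustar).

(* Every stage of the cycle is a correction u + N (f - A u) of the current
   iterate; hence the error map is indeed linear and independent of f. *)
Let consistent l (g : vec l -> vec l -> vec l) :=
  exists N : 'M[R]_(nr fe * nS fe l), forall f u,
    g f u = u + N *m (f - At fe l *m u).

Let consistent_comp l (g h : vec l -> vec l -> vec l) :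
  consistent g -> consistent h -> consistent (fun f u => h f (g f u)).
Proof.
move=> [N gE] [K hE]; exists (N + K *m (1%:M - At fe l *m N)) => f u.
have eE : f - At fe l *m (u + N *m (f - At fe l *m u)) =
          (1%:M - At fe l *m N) *m (f - At fe l *m u).
  by rewrite mulmxBl mul1mx [in LHS]mulmxDr opprD addrA mulmxA.
by rewrite hE gE eE [in RHS]mulmxDl mulmxA addrA.
Qed.

Let consistent_iter l (g : vec l -> vec l -> vec l) k :
  consistent g -> consistent (fun f => iter k (g f)).
Proof.
move=> gc; elim: k => [|k IH]; first by exists 0 => f u; rewrite mul0mx addr0.
exact: (consistent_comp IH gc).
Qed.

Let consistent_smooth l : consistent (@smooth l).
Proof.
exists (invmx (Wt l)) => f u.
by rewrite /smooth mulmxBl mul1mx mulmxBr !mulmxA addrCA.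
Qed.

Let consistent_vcycle l : consistent (@vcycle l).
Proof.
elim: l => [|l [N IH]] /=.
  by apply: (consistent_comp (consistent_iter _ _) (consistent_iter _ _));
    apply: consistent_smooth.
have cgc : consistent (fun f u : vec l.+1 =>
    u + Pt l *m vcycle (Rt l *m (f - At fe l.+1 *m u)) 0).
  exists (Pt l *m N *m Rt l) => f u.
  by rewrite IH add0r mulmx0 subr0 !mulmxA.
exact: (consistent_comp (consistent_comp
  (consistent_iter (nu_pre mg l.+1) (@consistent_smooth l.+1)) cgc)
  (consistent_iter (nu_post mg l.+1) (@consistent_smooth l.+1))).
Qed.

Lemma iteration_matrix_exists : exists M, iteration_matrix M.
Proof.
have [N NE] := consistent_vcycle (nlev fe).
exists (1%:M - N *m At fe (nlev fe)) => f u ustar <-.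
by rewrite NE mulmxBl mul1mx -mulmxBr -[_ - u]opprB !mulmxN -mulmxA addrAC.
Qed.

End Multigrid.

(* Main.v *)
Require Import Defs.
From mathcomp Require Import all_boot all_order all_algebra.
From mathcomp Require Import mxtens.
From mathcomp Require Import all_classical all_reals all_analysis.
From mathcomp Require Import ring lra.

Import Order.TTheory GRing.Theory Num.Theory.
Local Open Scope ring_scope.

(** Write A0 for the factorising matrix and D = A0^-1 dA, so that
    A0^-1 A = Id + D. The error propagation
    matrix is then Id - (Id - M^mu) (Id + D) = M^mu (Id + D) - D, and the bound
    follows from the triangle inequality and submultiplicativity of the operator
    norm. Invertibility of A = A0 (Id + D) follows from the injectivity of
    Id + D, as D is a strict contraction. *)

Section EnergyNorm.
Set Implicit Arguments.
Unset Strict Implicit.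
Context {R : realType} {n : nat} {A : 'M[R]_n}.
Hypothesis spdA : spdmx A.
Implicit Types (u v w : 'cV[R]_n) (B C : 'M[R]_n).

Let edot u v : R := (u^T *m (A *m v)) 0 0.
Local Notation nrm := (energy_norm A).
Local Notation opn B := (energy_opnorm A B).

Let edotC u v : edot u v = edot v u.
Proof.
have [symA _] := spdA.
have -> : edot u v = (u^T *m (A *m v))^T 0 0 by rewrite [RHS]mxE.
by rewrite !trmx_mul trmxK symA /edot mulmxA.
Qed.

Let edotDr u v w : edot u (v + w) = edot u v + edot u w.
Proof. by rewrite /edot !mulmxDr mxE. Qed.

Let edotZr a u v : edot u (a *: v) = a * edot u v.
Proof. by rewrite /edot -!scalemxAr mxE. Qed.

Let edotDl u v w : edot (u + v) w = edot u w + edot v w.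
Proof. by rewrite edotC edotDr !(edotC w). Qed.

Let edotZl a u v : edot (a *: u) v = a * edot u v.
Proof. by rewrite edotC edotZr edotC. Qed.

Let edot_gt0 v : v != 0 -> 0 < edot v v.
Proof. by have [_ posA] := spdA; rewrite /edot mulmxA; apply: posA. Qed.

Let edot_ge0 v : 0 <= edot v v.
Proof.
have [->|/edot_gt0/ltW//] := eqVneq v 0.
by rewrite /edot !mulmx0 mxE.
Qed.

Lemma energy_norm_ge0 v : 0 <= nrm v.
Proof. exact: sqrtr_ge0. Qed.

Let sqr_energy_norm v : nrm v ^+ 2 = edot v v.
Proof. exact: sqr_sqrtr (edot_ge0 v). Qed.

Lemma energy_norm0 : nrm 0 = 0.
Proof. by rewrite /energy_norm !mulmx0 mxE sqrtr0. Qed.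

Lemma energy_norm_eq0 v : (nrm v == 0) = (v == 0).
Proof.
have [->|/edot_gt0 v_gt0] := eqVneq v 0; first by rewrite energy_norm0 eqxx.
by rewrite gt_eqF// sqrtr_gt0.
Qed.

Lemma energy_normZ a v : nrm (a *: v) = `|a| * nrm v.
Proof.
by rewrite /energy_norm -!/(edot _ _) edotZl edotZr mulrA -expr2 sqrtrM
  ?sqr_ge0// sqrtr_sqr.
Qed.

Lemma energy_normN v : nrm (- v) = nrm v.
Proof. by rewrite -scaleN1r energy_normZ normrN1 mul1r. Qed.

Let edot_CauchySchwarz u v : `|edot u v| <= nrm u * nrm v.
Proof.
rewrite -ler_sqr ?nnegrE ?mulr_ge0 ?energy_norm_ge0//.
rewrite exprMn !sqr_energy_norm real_normK ?num_real//.
have [->|/edot_gt0 u_gt0] := eqVneq u 0.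
  by rewrite {1}/edot trmx0 mul0mx mxE expr0n mulr_ge0.
(* Up to the factor [edot u u], this vector is the component of [v] orthogonal to [u]. The scaling
   avoids a division; the positive factor [a] is cancelled at the end. *)
have := edot_ge0 (edot u u *: v + (- edot u v) *: u).
rewrite !(edotDl, edotDr, edotZl, edotZr) (edotC v u).
set a := edot u u; set b := edot u v; set c := edot v v.
have -> : a * (a * c + - b * b) + (a * (- b * b) + - b * (- b * a)) =
  a * (a * c - b ^+ 2) by ring.
by rewrite pmulr_rge0 ?subr_ge0.
Qed.

Lemma energy_normD u v : nrm (u + v) <= nrm u + nrm v.
Proof.
rewrite -ler_sqr ?nnegrE ?addr_ge0 ?energy_norm_ge0//.
rewrite sqrrD !sqr_energy_norm edotDl !edotDr (edotC v u).
have := le_trans (ler_norm _) (edot_CauchySchwarz u v).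
rewrite mulr2n; lra.
Qed.

(** A nonzero vector in the kernel would have zero energy. *)
Lemma spd_unitmx : A \in unitmx.
Proof.
rewrite -row_free_unit; apply: inj_row_free => v vA0.
apply: contraTeq (isT : true) => v_neq0.
have : 0 < edot v^T v^T by apply: edot_gt0; rewrite -trmx0 (inj_eq trmx_inj).
by rewrite /edot trmxK mulmxA vA0 mul0mx mxE ltxx.
Qed.

(* [v i] is the energy product of [v] with [A^-1 e_i], so Cauchy-Schwarz bounds
   every coordinate of [v] by its energy norm. *)
Lemma energy_norm_mulmx_bounded B : exists2 c, 0 <= c &
  forall v, nrm (B *m v) <= c * nrm v.
Proof.
pose e i : 'cV[R]_n := delta_mx i 0.
exists (\sum_i nrm (invmx A *m e i) * nrm (B *m e i)) => [|v].
  by apply: sumr_ge0 => i _; rewrite mulr_ge0 ?energy_norm_ge0.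
have vE : v = \sum_i v i 0 *: e i.
  by rewrite [LHS]matrix_sum_delta; apply: eq_bigr => i _; rewrite big_ord1.
have coordE i : v i 0 = edot v (invmx A *m e i).
  by rewrite /edot mulKVmx ?spd_unitmx// -colE !mxE.
rewrite {1}vE mulmx_sumr mulr_suml.
apply: (@le_trans _ _ (\sum_i nrm (v i 0 *: (B *m e i)))).
  under eq_bigr do rewrite -scalemxAr.
  elim/big_ind2: _ => [|x a y b xa yb|//]; first by rewrite energy_norm0.
  exact: le_trans (energy_normD _ _) (lerD xa yb).
apply: ler_sum => i _; rewrite energy_normZ mulrAC ler_wpM2r ?energy_norm_ge0//.
by rewrite mulrC coordE edot_CauchySchwarz.
Qed.

Lemma energy_opnorm_le B c : 0 <= c ->
  (forall v, nrm (B *m v) <= c * nrm v) -> opn B <= c.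
Proof.
move=> c_ge0 Bc; apply: ge_sup => [|_ [v /= v_le1 <-]].
  (* [ge_sup] asks for a nonempty set; the zero vector lies in the unit ball in every dimension. *)
  by exists (nrm (B *m 0)); exists 0 => //=; rewrite energy_norm0.
by apply: le_trans (Bc v) _; rewrite ler_piMr.
Qed.

(** [sup] dominates the elements of a nonempty set only when that set is bounded above;
    [energy_norm_mulmx_bounded] supplies such a bound. *)
Lemma energy_opnorm_ub B v : nrm v <= 1 -> nrm (B *m v) <= opn B.
Proof.
move=> v_le1; apply: ub_le_sup; last by exists v.
have [c c_ge0 Bc] := energy_norm_mulmx_bounded B.
exists c => _ [w /= w_le1 <-].
by apply: le_trans (Bc w) _; rewrite ler_piMr.
Qed.

Lemma energy_opnorm_ge0 B : 0 <= opn B.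
Proof.
by apply: le_trans (energy_norm_ge0 _) (@energy_opnorm_ub B 0 _);
  rewrite energy_norm0.
Qed.

(** A nonzero [v] is scaled to norm 1, which brings it into the ball over which the supremum is
    taken. *)
Lemma energy_norm_mulmx B v : nrm (B *m v) <= opn B * nrm v.
Proof.
have [->|v_neq0] := eqVneq v 0; first by rewrite mulmx0 energy_norm0 mulr0.
have v_gt0 : 0 < nrm v by rewrite lt_def energy_norm_eq0 v_neq0 energy_norm_ge0.
rewrite -ler_pdivrMr// mulrC -[(nrm v)^-1]ger0_norm ?invr_ge0 ?(ltW v_gt0)//.
rewrite -energy_normZ scalemxAr energy_opnorm_ub// energy_normZ.
by rewrite ger0_norm ?invr_ge0 ?(ltW v_gt0)// mulVf// gt_eqF.
Qed.

(** Equality fails in dimension 0, where every operator norm is 0. *)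
Lemma energy_opnorm1 : opn 1%:M <= 1.
Proof. by apply: energy_opnorm_le => // v; rewrite mul1mx mul1r. Qed.

Lemma energy_opnormB B C : opn (B - C) <= opn B + opn C.
Proof.
apply: energy_opnorm_le => [|v]; first by rewrite addr_ge0 ?energy_opnorm_ge0.
rewrite mulmxBl mulrDl (le_trans (energy_normD _ _))// energy_normN.
by rewrite lerD ?energy_norm_mulmx.
Qed.

Lemma energy_opnormD B C : opn (B + C) <= opn B + opn C.
Proof.
apply: energy_opnorm_le => [|v]; first by rewrite addr_ge0 ?energy_opnorm_ge0.
rewrite mulmxDl mulrDl (le_trans (energy_normD _ _))//.
by rewrite lerD ?energy_norm_mulmx.
Qed.

Lemma energy_opnormM B C : opn (B *m C) <= opn B * opn C.
Proof.
apply: energy_opnorm_le => [|v]; first by rewrite mulr_ge0 ?energy_opnorm_ge0.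
rewrite -mulmxA -mulrA (le_trans (energy_norm_mulmx _ _))//.
by rewrite ler_wpM2l ?energy_opnorm_ge0 ?energy_norm_mulmx.
Qed.

Lemma energy_opnormX B k : opn (B ^+ k) <= opn B ^+ k.
Proof.
elim: k => [|k IHk]; first by rewrite !expr0 energy_opnorm1.
rewrite !exprS (le_trans (energy_opnormM _ _))//.
by rewrite ler_wpM2l ?energy_opnorm_ge0.
Qed.

(** A kernel vector [v] satisfies [v = - (B *m v)]; if nonzero, it would be strictly shorter than
    itself. *)
Lemma unitmx_1D_contraction B : opn B < 1 -> 1%:M + B \in unitmx.
Proof.
(* [inj_row_free] tests row vectors from the left; transposing the matrix turns them into columns on
   which [B] acts. *)
move=> B_lt1; rewrite -unitmx_tr -row_free_unit; apply: inj_row_free => v v0.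
have vE : v^T = - (B *m v^T).
  apply/eqP; rewrite -addr_eq0; apply/eqP.
  by rewrite -[X in X + _]mul1mx -mulmxDl -[LHS]trmxK trmx_mul trmxK v0 trmx0.
apply: trmx_inj; rewrite trmx0; apply/eqP; rewrite -energy_norm_eq0.
have := energy_norm_mulmx B v^T; rewrite -energy_normN -vE => v_le.
rewrite eq_le energy_norm_ge0 andbT leNgt; apply/negP => v_gt0.
by move: v_le; rewrite leNgt gtr_pMl ?B_lt1.
Qed.

End EnergyNorm.

Theorem mainTheorem2 (R : realType) (pb : shell_problem R)
    (fe : tensor_fem pb) (mg : tensor_mg fe)
    (A dA M : 'M[R]_(nr fe * nS fe (nlev fe))) (mu : nat) :
  let AL := At fe (nlev fe) in
  let Delta := energy_opnorm AL (invmx AL *m dA) in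
  let rhot := energy_opnorm AL M in
  let rho := energy_opnorm AL
    (1%:M - (1%:M - M ^+ mu) *m (invmx AL *m A)) in
  spdmx AL ->
  A = AL + dA ->
  Delta < 1 ->
  iteration_matrix mg M ->
  rhot < 1 ->
  (1 <= mu)%N ->
  [/\ A \in unitmx,
      forall (f : 'cV[R]_(nr fe * nS fe (nlev fe)))
             (u : nat -> 'cV[R]_(nr fe * nS fe (nlev fe))),
        (forall k, u k.+1 =
           u k + (1%:M - M ^+ mu) *m (invmx AL *m (f - A *m u k))) ->
        forall k, energy_norm AL (u k.+1 - invmx A *m f)
                  <= rho * energy_norm AL (u k - invmx A *m f),
      rho <= Delta + (1 + Delta) * rhot ^+ mu,
      0 < rhot -> rlog rhot ((1 - Delta) / (1 + Delta)) < mu%:R -> rho < 1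
    & mu = 1%N -> Delta < (1 - rhot) / (1 + rhot) -> rho < 1].
Proof.
move=> AL Delta rhot rho spdAL AE Delta_lt1 _ rhot_lt1 _.
have ALu : AL \in unitmx := spd_unitmx spdAL.
pose D := invmx AL *m dA.
have DE : invmx AL *m A = 1%:M + D by rewrite AE mulmxDr mulVmx.
have Au : A \in unitmx.
  rewrite -[A](mulKVmx ALu) DE unitmx_mul ALu.
  exact: (unitmx_1D_contraction spdAL).
have Delta_ge0 : 0 <= Delta := energy_opnorm_ge0 spdAL _.
have Delta1_gt0 : 0 < 1 + Delta by rewrite ltr_wpDr.
have rhot_ge0 : 0 <= rhot := energy_opnorm_ge0 spdAL _.
have rho_le : rho <= Delta + (1 + Delta) * rhot ^+ mu.
  rewrite /rho DE mulmxBl mul1mx.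
  have -> : 1%:M - (1%:M + D - M ^+ mu *m (1%:M + D)) =
            M ^+ mu *m (1%:M + D) - D.
    by rewrite opprB addrCA opprD addNKr.
  rewrite (le_trans (energy_opnormB spdAL _ _))// addrC lerD2l.
  rewrite (le_trans (energy_opnormM spdAL _ _))// mulrC.
  rewrite ler_pM ?(energy_opnorm_ge0 spdAL) ?(energy_opnormX spdAL)//.
  rewrite (le_trans (energy_opnormD spdAL _ _))// lerD2r.
  exact: energy_opnorm1.
(* This is the bound [rho_le] being below 1, solved for [rhot ^+ mu]; both sufficient conditions
   reduce to it. *)
have rho_lt1 : rhot ^+ mu < (1 - Delta) / (1 + Delta) -> rho < 1.
  rewrite ltr_pdivlMr// => lt_1BDelta.
  by apply: le_lt_trans rho_le _; rewrite mulrC -ltrBrDl.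
split=> //.
- move=> f u uE k.
  have -> : u k.+1 - invmx A *m f =
      (1%:M - (1%:M - M ^+ mu) *m (invmx AL *m A)) *m (u k - invmx A *m f).
    (* The residual is minus [A] applied to the error, so that one step acts linearly on the
       error. *)
    have fE : f - A *m u k = - (A *m (u k - invmx A *m f)).
      by rewrite mulmxBr mulKVmx// opprB.
    rewrite uE fE; move: (1%:M - M ^+ mu) => K.
    by rewrite mulmxBl mul1mx !mulmxN -!mulmxA addrAC.
  exact: (energy_norm_mulmx spdAL).
- move=> rhot_gt0 mu_gt; apply: rho_lt1.
  have x_gt0 : 0 < (1 - Delta) / (1 + Delta).
    by rewrite divr_gt0 ?subr_gt0.
  (* Taking logarithms preserves the order, but [ln rhot] is negative because [rhot < 1], so
     dividing by it reverses the inequality and gives a lower bound on [mu]. *)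
  rewrite -ltr_ln ?posrE ?exprn_gt0// lnXn// -mulr_natl.
  by rewrite -ltr_ndivrMr// ln_lt0// rhot_gt0.
- move=> mu1 Delta_lt; apply: rho_lt1; rewrite mu1 expr1.
  have rhot1_gt0 : 0 < 1 + rhot by rewrite ltr_wpDr.
  (* The condition is symmetric in [Delta] and [rhot]: once denominators are cleared, both
     inequalities say [Delta + rhot + Delta * rhot < 1]. *)
  move: Delta_lt; rewrite !ltr_pdivlMr//; lra.
Qed.
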